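(* Let $(T^*Q,\omega,H,F,W)$ be an RCH system with $\omega$ the canonical symplectic form on $T^*Q$, and let $\tilde X=X_{(T^*Q,\omega,H,F,u)}$ be its dynamical vector field with a control law $u$. Let $\gamma:Q\to T^*Q$ be a one-form on $Q$, $\lambda=\gamma\circ\pi_Q:T^*Q\to T^*Q$, and for any symplectic map $\varepsilon:T^*Q\to T^*Q$ denote $\tilde X^\varepsilon=T\pi_Q\circ\tilde X\circ\varepsilon$. Then $\varepsilon$ is a solution of the equation $$T\varepsilon\circ X_{H\circ\varepsilon}=T\lambda\circ\tilde X\circ\varepsilon$$ if and only if it is a solution of the equation $$T\gamma\circ\tilde X^\varepsilon=X_H\circ\varepsilon ,$$ where $X_H$ and $X_{H\circ\varepsilon}$ are the Hamiltonian vector fields on $T^*Q$ of the functions $H$ and $H\circ\varepsilon:T^*Q\to\mathbb R$, respectively. (The equation $T\gamma\circ\tilde X^\varepsilon=X_H\circ\varepsilon$ is called the Type II of Hamilton-Jacobi equation for the RCH system with control law $u$.)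
   Context: All manifolds and maps are smooth and finite dimensional. $Q$ is a manifold, $\pi_Q:T^*Q\to Q$ the projection, $\omega=-\mathbf d\theta$ the canonical symplectic form with $\theta$ the canonical one-form on $T^*Q$. For a function $K$ on $T^*Q$, $X_K$ is defined by $\mathbf i_{X_K}\omega=\mathbf dK$. A map $\varepsilon:T^*Q\to T^*Q$ is symplectic if $\varepsilon^*\omega=\omega$. A one-form on $Q$ is regarded as a section $\gamma:Q\to T^*Q$. An RCH (regular controlled Hamiltonian) system on $T^*Q$ is a 5-tuple $(T^*Q,\omega,H,F,W)$ where $H:T^*Q\to\mathbb R$ is a function (Hamiltonian), $F:T^*Q\to T^*Q$ is a fiber-preserving map (external force map: it maps each fiber $T_x^*Q$ to itself), and $W\subset T^*Q$ is a fiber submanifold (control subset). A (feedback) control law is a fiber-preserving map $u:T^*Q\to W$. Vertical lift: fix a metric giving a splitting $T(T^*Q)=\mathcal H\oplus\mathcal V$ with $\mathcal V=\ker T\pi_Q$. For a fiber-preserving map $F$, $\mathrm{vlift}(F)X_H(\alpha_x)$ is the vertical vector at $\alpha_x\in T_x^*Q$ obtained by taking the vertical part of $TF(X_H(\alpha_x))\in T_{F(\alpha_x)}T^*Q$ and parallel-translating it along the straight line in $T^*_xQ$ from $F(\alpha_x)$ to $\alpha_x$. One writes $\mathrm{vlift}(F)$ for $\mathrm{vlift}(F)X_H$, and similarly $\mathrm{vlift}(u)$. The dynamical vector field of the system with control law $u$ is $X_{(T^*Q,\omega,H,F,u)}=X_H+\mathrm{vlift}(F)+\mathrm{vlift}(u)$.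 *)

(* Defs.v *)
From HB Require Import structures.
From mathcomp Require Import all_boot all_order all_algebra.
From mathcomp Require Import all_classical all_reals all_analysis.
Import Order.TTheory GRing.Theory Num.Theory.
Import numFieldNormedType.Exports.

Set Implicit Arguments.
Unset Strict Implicit.
Unset Printing Implicit Defensive.

Local Open Scope classical_set_scope.
Local Open Scope ring_scope.

(** * Smooth functions on open subsets of R^m *)

(* For U open in a finite-dimensional V: f is C^(k+1) on U when it is
   (Frechet) differentiable on U with all directional derivatives C^k. *)
Fixpoint Ck (R : realType) (V W : normedModType R) (k : nat)
    (U : set V) (f : V -> W) {struct k} : Prop :=
  match k with
  | 0 => forall x, U x -> {for x, continuous f}
  | k'.+1 => (forall x, U x -> differentiable f x) /\
             (forall v : V, Ck k' U (fun x => 'd f x v))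
  end.

Definition smooth (R : realType) (V W : normedModType R)
    (U : set V) (f : V -> W) : Prop :=
  forall k, Ck k U f.

(** * Manifolds *)

(* The data of an atlas.  [chart_param c] is the inverse of the chart
   [chart_coord c]; it is only meaningful on [chart_coord c @` chart_dom c].
   [chart_at x] is a selected chart around x: it serves only to represent a
   tangent vector at x by its components (see [tangent] below). *)
Record charted_space (R : realType) (m : nat) := ChartedSpace {
  carrier :> Type;
  chart : Type;
  chart_dom : chart -> set carrier;
  chart_coord : chart -> carrier -> 'rV[R]_m;
  chart_param : chart -> 'rV[R]_m -> carrier;
  chart_at : carrier -> chart }.

Section Manifold.
Variables (R : realType) (m : nat) (M : charted_space R m).

(* The manifold topology, i.e. the one that makes the charts homeomorphisms
   onto open subsets of R^m. *)
Definition mopen (A : set M) : Prop :=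
  forall c : chart M, open (chart_coord c @` (chart_dom c `&` A)).

Record is_manifold : Prop := IsManifold {
  chart_coordK : forall (c : chart M) x,
    chart_dom c x -> chart_param c (chart_coord c x) = x;
  dom_chart_at : forall x : M, chart_dom (chart_at x) x;
  overlap_open : forall c d : chart M,
    open (chart_coord c @` (chart_dom c `&` chart_dom d));
  transition_smooth : forall c d : chart M,
    smooth (chart_coord c @` (chart_dom c `&` chart_dom d))
      (chart_coord d \o chart_param c);
  manifold_hausdorff : forall x y : M, x <> y ->
    exists A B : set M, [/\ mopen A, mopen B, A x, B y & A `&` B = set0];
  manifold_second_countable : exists B : nat -> set M,
    (forall i, mopen (B i)) /\
    (forall (A : set M) x, mopen A -> A x -> exists i, B i x /\ B i `<=` A) }.

(* [smooth_fun A f] : f is smooth on the open set A of M. *)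
Definition smooth_fun (V : normedModType R) (A : set M) (f : M -> V) : Prop :=
  forall c : chart M,
    smooth (chart_coord c @` (chart_dom c `&` A)) (f \o chart_param c).

(* The tangent bundle.  The vector (x, v) is the one at x whose components in
   the chart [chart_at x] are v. *)
Definition tangent : Type := (M * 'rV[R]_m)%type.

(* The tangent vector at [chart_param c y] whose components in the chart c
   (rather than in [chart_at (chart_param c y)]) are v. *)
Definition chart_vector (c : chart M) (y v : 'rV[R]_m) : tangent :=
  let x := chart_param c y in
  (x, 'd (chart_coord (chart_at x) \o chart_param c) y v).

Definition differential (V : normedModType R) (f : M -> V) (x : M)
    (v : 'rV[R]_m) : V :=
  'd (f \o chart_param (chart_at x)) (chart_coord (chart_at x) x) v.

(* Exterior derivative of a one-form: in the chart c = chart_at x,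
   (d eta)_x (u, v) = D_u (eta (v)) - D_v (eta (u)),
   where u and v are extended as constant fields in the chart c. *)
Definition exterior_derivative (eta : tangent -> R) (x : M)
    (u v : 'rV[R]_m) : R :=
  let c := chart_at x in
  'd (fun y => eta (chart_vector c y v) : R) (chart_coord c x) u -
  'd (fun y => eta (chart_vector c y u) : R) (chart_coord c x) v.

Record riemannian_metric (g : M -> 'rV[R]_m -> 'rV[R]_m -> R) : Prop := {
  metric_linear : forall x (a : R) u v w,
    g x (a *: u + v) w = a * g x u w + g x v w;
  metric_sym : forall x u v, g x u v = g x v u;
  metric_pos : forall x u, u != 0 -> 0 < g x u u;
  metric_smooth : forall (c : chart M) u v,
    smooth (chart_coord c @` chart_dom c)
    (fun y => g (chart_param c y)
                (chart_vector c y u).2 (chart_vector c y v).2 : R)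
}.

End Manifold.

Definition smooth_map (R : realType) (m p : nat) (M : charted_space R m)
    (N : charted_space R p) (f : M -> N) : Prop :=
  forall (c : chart M) (d : chart N),
    let U := chart_coord c @` (chart_dom c `&` f @^-1` chart_dom d) in
    open U /\ smooth U (chart_coord d \o f \o chart_param c).

Definition tangent_map (R : realType) (m p : nat) (M : charted_space R m)
    (N : charted_space R p) (f : M -> N) (v : tangent M) : tangent N :=
  let c := chart_at v.1 in
  (f v.1, 'd (chart_coord (chart_at (f v.1)) \o f \o chart_param c)
             (chart_coord c v.1) v.2).

(** * The cotangent bundle *)

(* The covector (x, p) is the linear form v |-> p v^T on T_xQ; as for tangent
   vectors, its components p refer to the chart [chart_at x].  A chart c of Q
   induces the chart (x, p) |-> (q, p_c) of T^*Q where q = chart_coord c x and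
   p_c are the components of the same covector in the chart c. *)
Definition cotangent (R : realType) (n : nat) (Q : charted_space R n) :
    charted_space R (n + n) :=
  {| carrier := (Q * 'rV[R]_n)%type;
     chart := chart Q;
     chart_dom := fun c a => chart_dom c a.1;
     chart_coord := fun c a =>
       row_mx (chart_coord c a.1)
         (a.2 *m ('J (chart_coord (chart_at a.1) \o chart_param c)
                     (chart_coord c a.1))^T);
     chart_param := fun c y =>
       let x := chart_param c (lsubmx y) in
       (x, rsubmx y *m
             ('J (chart_coord c \o chart_param (chart_at x))
                 (chart_coord (chart_at x) x))^T);
     chart_at := fun a => chart_at a.1 |}.

Section Cotangent.
Variables (R : realType) (n : nat) (Q : charted_space R n).
Local Notation TsQ := (cotangent Q).

Definition cot_proj (a : TsQ) : Q := a.1.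

Definition one_form (gamma : Q -> TsQ) : Prop :=
  smooth_map gamma /\ (forall x, cot_proj (gamma x) = x).

Definition pairing (p v : 'rV[R]_n) : R := (p *m v^T) 0 0.

(* theta_a (w) = <a, T pi_Q (w)> *)
Definition canonical_one_form (w : tangent TsQ) : R :=
  pairing w.1.2 (tangent_map cot_proj w).2.

Definition omega (a : TsQ) (u v : 'rV[R]_(n + n)) : R :=
  - exterior_derivative canonical_one_form a u v.

Definition symplectic (eps : TsQ -> TsQ) : Prop :=
  smooth_map eps /\
  (forall a u v, omega (eps a) (tangent_map eps (a, u)).2
                               (tangent_map eps (a, v)).2 = omega a u v).

(* X_K (a) is the vector X with omega_a (X, v) = dK_a (v) for all v. *)
Definition hamiltonian_vf (K : TsQ -> R) (a : TsQ) : tangent TsQ :=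
  (a, xget 0 [set X | forall v, omega a X v = differential K a v]).

Definition fiber_preserving (F : TsQ -> TsQ) : Prop :=
  forall a, cot_proj (F a) = cot_proj a.

(** ** Vertical lifts *)

Definition vertical (a : TsQ) (v : 'rV[R]_(n + n)) : Prop :=
  (tangent_map cot_proj (a, v)).2 = 0.

(* Velocity at s = 0 of the straight line a + s p in the fiber of a. *)
Definition line_velocity (a : TsQ) (p : 'rV[R]_n) : 'rV[R]_(n + n) :=
  'D_1 (fun s : R => chart_coord (chart_at a) ((a.1, a.2 + s *: p) : TsQ)) 0.

(* Component of w in ker T pi_Q for the g-orthogonal splitting. *)
Definition vertical_part (g : TsQ -> 'rV[R]_(n + n) -> 'rV[R]_(n + n) -> R)
    (w : tangent TsQ) : tangent TsQ :=
  (w.1, xget 0 [set v | vertical w.1 v /\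
    forall v', vertical w.1 v' -> g w.1 (w.2 - v) v' = 0]).

(* Translates a vertical vector w, based in the fiber of a, to a along a
   straight line: the velocity of b + s p goes to that of a + s p. *)
Definition fiber_translate (w : tangent TsQ) (a : TsQ) : tangent TsQ :=
  (a, line_velocity a (xget 0 [set p | line_velocity w.1 p = w.2])).

Definition vlift (g : TsQ -> 'rV[R]_(n + n) -> 'rV[R]_(n + n) -> R)
    (F : TsQ -> TsQ) (X : TsQ -> tangent TsQ) (a : TsQ) : tangent TsQ :=
  fiber_translate (vertical_part g (tangent_map F (X a))) a.

(** ** Regular controlled Hamiltonian systems *)

(* W is an embedded submanifold of T^*Q on which pi_Q is a submersion: near
   each of its points it is the zero set of a smooth map f whose derivative
   along the fiber is onto. *)
Definition fiber_submanifold (W : set TsQ) : Prop :=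
  forall a, W a -> exists (k : nat) (U : set TsQ) (f : TsQ -> 'rV[R]_k),
    [/\ mopen U /\ U a,
        smooth_fun U f,
        forall b, U b -> (W b <-> f b = 0) &
        forall t, exists p, differential f a (line_velocity a p) = t].

Record RCH_system := RCHSystem {
  hamiltonian : TsQ -> R;
  force : TsQ -> TsQ;
  control_set : set TsQ;
  hamiltonian_smooth : smooth_fun setT hamiltonian;
  force_smooth : smooth_map force;
  force_fiber : fiber_preserving force;
  control_set_fiber : fiber_submanifold control_set }.

Definition control_law (S : RCH_system) (u : TsQ -> TsQ) : Prop :=
  [/\ smooth_map u, fiber_preserving u & forall a, control_set S (u a)].

Definition dynamical_vf (g : TsQ -> 'rV[R]_(n + n) -> 'rV[R]_(n + n) -> R)
    (S : RCH_system) (u : TsQ -> TsQ) (a : TsQ) : tangent TsQ :=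
  let X := hamiltonian_vf (hamiltonian S) in
  (a, (X a).2 + (vlift g (force S) X a).2 + (vlift g u X a).2).

End Cotangent.

(* Main.v *)
(* In the chart of T^*Q induced by a chart of Q the canonical one-form is p dq,
   so omega is the constant standard symplectic form, in particular
   nondegenerate.  Hence T eps is invertible at each point when eps is
   symplectic, and T eps o X_{H o eps} = X_H o eps.  Moreover
   T lambda = T gamma o T pi_Q by the chain rule, so the two equations have the
   same pair of sides. *)
Require Import Defs.
From HB Require Import structures.
From mathcomp Require Import all_boot all_order all_algebra.
From mathcomp Require Import all_classical all_reals all_analysis.
Import Order.TTheory GRing.Theory Num.Theory.
Import numFieldNormedType.Exports.

Set Implicit Arguments.
Unset Strict Implicit.
Unset Printing Implicit Defensive.

Local Open Scope classical_set_scope.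
Local Open Scope ring_scope.

(** * Differential calculus of maps known only near a point *)

Section NearDiff.
Variables (R : realType) (V W : normedModType R).

(** A differential is determined by its first-order expansion, which only sees values near [x], the
    value at [x] included. Chart expressions need this: they take a usable form only on a chart
    image, outside which [chart_param] is arbitrary. *)
Lemma near_eq_diff (f g : V -> W) (x : V) :
  (\near x, f x = g x) -> differentiable f x ->
  differentiable g x /\ 'd g x = 'd f x :> (V -> W).
Proof.
move=> fg df; have [dfc /eqaddoP dfo] := (diff_locallyP _ _).1 df.
have gE : g \o shift x = cst (g x) + 'd f x +o_ 0 id.
  apply/eqaddoP => e e0; have := dfo e e0.
  have fgx : f x = g x by exact: (nbhs_singleton fg).
  have : \forall h \near 0, f (h + x) = g (h + x).
    by move: fg; rewrite (near_shift 0 x) subr0.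
  apply: filterS2 => h /= fgh.
  by rewrite !fctE /= /cst /shift /= -fgh -fgx.
have dg := diff_unique dfc gE.
by split; [apply/diff_locallyP; rewrite dg | exact: dg].
Qed.

End NearDiff.

Section DiffMatrix.
Variables (R : realType) (V : normedModType R).

Lemma differentiable_rV (p : nat) (f : V -> 'rV[R]_p) (x : V) :
  (forall j, differentiable (fun y => f y 0 j : R) x) -> differentiable f x.
Proof.
move=> df.
rewrite (_ : f = \sum_j (fun y => f y 0 j *: (delta_mx 0 j : 'rV[R]_p))); last first.
  by apply/funext => y; rewrite fct_sumE [LHS]row_sum_delta.
by apply: differentiable_sum => j; apply: differentiableZl.
Qed.

Lemma differentiable_mx_entry (m p : nat) (f : V -> 'M[R]_(m, p)) (x : V) i j :
  differentiable f x -> differentiable (fun y => f y i j : R) x.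
Proof.
move=> df; pose entry (A : 'M[R]_(m, p)) : R := A i j.
exact: (@differentiable_comp _ _ _ _ f entry x df (differentiable_coord _ _ _)).
Qed.

Lemma differentiable_row_mx (p q : nat) (f : V -> 'rV[R]_p) (h : V -> 'rV[R]_q) x :
  differentiable f x -> differentiable h x ->
  differentiable (fun y => row_mx (f y) (h y)) x.
Proof.
move=> df dh; apply: differentiable_rV => j.
rewrite -(splitK j); case: (fintype.split j) => k /=.
  rewrite (_ : (fun y => _) = (fun y => f y 0 k)); first exact: differentiable_mx_entry.
  by apply/funext => y; rewrite row_mxEl.
rewrite (_ : (fun y => _) = (fun y => h y 0 k)); first exact: differentiable_mx_entry.
by apply/funext => y; rewrite row_mxEr.
Qed.

Lemma differentiable_mulmx (p q : nat) (f : V -> 'rV[R]_p) (A : V -> 'M[R]_(p, q)) x :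
  differentiable f x -> (forall i j, differentiable (fun y => A y i j : R) x) ->
  differentiable (fun y => f y *m A y) x.
Proof.
move=> df dA; apply: differentiable_rV => j.
rewrite (_ : (fun y => _) = \sum_k ((fun y => f y 0 k) * (fun y => A y k j))).
  by apply: differentiable_sum => k; apply: differentiableM; first exact: differentiable_mx_entry.
by apply/funext => y; rewrite mxE fct_sumE.
Qed.

End DiffMatrix.

Lemma diffEjacobian (R : realType) (m p : nat) (f : 'rV[R]_m -> 'rV[R]_p) x v :
  'd f x v = v *m 'J f x.
Proof. by rewrite mul_rV_lin1. Qed.

Lemma jacobian_comp (R : realType) (m p q : nat) (f : 'rV[R]_m -> 'rV[R]_p)
    (h : 'rV[R]_p -> 'rV[R]_q) x :
  differentiable f x -> differentiable h (f x) ->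
  'J (h \o f) x = 'J f x *m 'J h (f x).
Proof.
move=> df dh; apply/row_matrixP => i.
by rewrite !rowE mulmxA -!diffEjacobian diff_comp.
Qed.

Lemma near_eq_jacobian (R : realType) (m p : nat) (f h : 'rV[R]_m -> 'rV[R]_p) x :
  (\near x, f x = h x) -> differentiable f x -> 'J h x = 'J f x.
Proof.
move=> fh df; have [_ dh] := near_eq_diff fh df.
rewrite /jacobian; exact (congr1 (@lin1_mx _ _ _) dh).
Qed.

Lemma jacobian_id (R : realType) (m : nat) (x : 'rV[R]_m) : 'J id x = 1%:M.
Proof.
have did : 'd id x = id :> ('rV[R]_m -> 'rV[R]_m) .
  exact: diff_val.
rewrite /jacobian; transitivity (lin1_mx (@id 'rV[R]_m)).
  exact (congr1 (@lin1_mx _ _ _) did).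
by apply/matrixP => i j; rewrite !mxE eqxx eq_sym.
Qed.

(** The chain rule in charts: inserting [chart_param d \o chart_coord d] between [f] and [K] is
    harmless near the point. The atlas facts are separate hypotheses so that [cot_coordK] and
    [dom_cot_chart_at] can supply them for the cotangent bundle. *)
Lemma differential_comp (R : realType) (m p : nat) (M : charted_space R m)
    (N : charted_space R p) (V : normedModType R) (f : M -> N) (K : N -> V) x v :
  (forall (c : chart M) z, chart_dom c z -> chart_param c (chart_coord c z) = z) ->
  (forall z : M, chart_dom (chart_at z) z) ->
  (forall (d : chart N) z, chart_dom d z -> chart_param d (chart_coord d z) = z) ->
  (forall z : N, chart_dom (chart_at z) z) ->
  smooth_map f -> smooth_fun setT K ->
  differential (K \o f) x v = differential K (f x) (tangent_map f (x, v)).2.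
Proof.
move=> MK Mat NK Nat sf sK; rewrite /differential /tangent_map /=.
set c := chart_at x; set d := chart_at (f x).
have [oU /(_ 1) [dU _]] := sf c d.
have Ux : (chart_coord c @` (chart_dom c `&` f @^-1` chart_dom d)) (chart_coord c x).
  by exists x => //; split; [exact: Mat | exact: Nat].
have {dU}df := dU _ Ux.
have fx : (chart_coord d \o f \o chart_param c) (chart_coord c x) = chart_coord d (f x).
  by rewrite /= MK //; exact: Mat.
have dK : differentiable (K \o chart_param d) (chart_coord d (f x)).
  have [+ _] := sK d 1; apply; exists (f x) => //; split=> //; exact: Nat.
rewrite -fx in dK *.
have KfE : 'd (K \o f \o chart_param c) (chart_coord c x) =
    'd ((K \o chart_param d) \o (chart_coord d \o f \o chart_param c))
      (chart_coord c x) :> (_ -> _).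
  apply: (near_eq_diff _ (differentiable_comp df dK)).2.
  have : \forall z \near chart_coord c x,
      (chart_coord c @` (chart_dom c `&` f @^-1` chart_dom d)) z.
    by apply: open_nbhs_nbhs.
  by apply: filterS => _ [z [cz dz] <-]; rewrite /= !MK ?NK.
exact (etrans (congr1 (@^~ v) KfE) (congr1 (@^~ v) (diff_comp df dK))).
Qed.

(** * Transition maps of Q and of its cotangent bundle *)

Section Charts.
Variables (R : realType) (n : nat) (Q : charted_space R n) (hQ : is_manifold Q).
Local Notation TsQ := (cotangent Q).

Definition transition (c d : chart Q) : 'rV[R]_n -> 'rV[R]_n :=
  chart_coord d \o chart_param c.

Definition overlap (c d : chart Q) : set 'rV[R]_n :=
  chart_coord c @` (chart_dom c `&` chart_dom d).

Lemma chart_coord_overlap c d x :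
  chart_dom c x -> chart_dom d x -> overlap c d (chart_coord c x).
Proof. by move=> cx dx; exists x. Qed.

Lemma transition_coord c d x : chart_dom c x ->
  transition c d (chart_coord c x) = chart_coord d x.
Proof. by move=> cx; rewrite /transition /= chart_coordK. Qed.

Lemma near_overlap c d y : overlap c d y -> \forall z \near y, overlap c d z.
Proof. by move=> cdy; apply: open_nbhs_nbhs; split=> //; exact: overlap_open. Qed.

Lemma differentiable_transition c d y :
  overlap c d y -> differentiable (transition c d) y.
Proof. by move=> cdy; have [+ _] := transition_smooth hQ c d 1; exact. Qed.

(** Row [i] of the Jacobian is the derivative along the i-th basis vector, which is C^1 because the
    transition is C^2. *)
Lemma differentiable_transition_jacobian c d y i j : overlap c d y ->
  differentiable (fun z => 'J (transition c d) z i j : R) y.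
Proof.
move=> cdy; have [_ /(_ (delta_mx 0 i)) [+ _]] := transition_smooth hQ c d 2.
move=> /(_ _ cdy) /(differentiable_mx_entry 0 j).
rewrite (_ : (fun z => _) = fun z => 'J (transition c d) z i j) //.
by apply/funext => z; rewrite diffEjacobian -rowE mxE.
Qed.

(** The cocycle identity, by the chain rule. Vectors are rows, so the factors read from left to
    right. *)
Lemma jacobian_transition_comp c d e x :
  chart_dom c x -> chart_dom d x -> chart_dom e x ->
  'J (transition c d) (chart_coord c x) *m 'J (transition d e) (chart_coord d x) =
  'J (transition c e) (chart_coord c x).
Proof.
move=> cx dx ex.
have dcd := differentiable_transition (chart_coord_overlap cx dx).
have dde := differentiable_transition (chart_coord_overlap dx ex).
rewrite -(transition_coord d cx) in dde *.
rewrite -(jacobian_comp dcd dde).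
apply: near_eq_jacobian; last exact/differentiable_transition/chart_coord_overlap.
apply: filterS (near_overlap (chart_coord_overlap cx dx)) => _ [z [cz dz] <-].
by rewrite /= !transition_coord.
Qed.

Lemma jacobian_transition_id c x : chart_dom c x ->
  'J (transition c c) (chart_coord c x) = 1%:M.
Proof.
move=> cx; rewrite -(jacobian_id (chart_coord c x)).
apply: near_eq_jacobian; last exact: ex_diff.
apply: filterS (near_overlap (chart_coord_overlap cx cx)) => _ [z [cz _] <-].
by rewrite transition_coord.
Qed.

(** The transposed Jacobians between [c] and the selected chart are mutually inverse by the cocycle
    identity. *)
Lemma cot_coordK (c : chart TsQ) (a : TsQ) :
  chart_dom c a -> chart_param c (chart_coord c a) = a.
Proof.
move: a => [x p] /= cx; rewrite row_mxKl row_mxKr chart_coordK //.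
have xx := dom_chart_at hQ x.
by rewrite -mulmxA -trmx_mul jacobian_transition_comp // jacobian_transition_id // trmx1 mulmx1.
Qed.

Lemma dom_cot_chart_at (a : TsQ) : chart_dom (chart_at a) a.
Proof. exact (dom_chart_at hQ a.1). Qed.

Definition cot_transition (c d : chart TsQ) : 'rV[R]_(n + n) -> 'rV[R]_(n + n) :=
  chart_coord d \o chart_param c.

(** Covectors change by the transposed Jacobian of the inverse transition. The cocycle identity
    eliminates the selected chart [chart_at x], whose dependence on [x] need not be continuous. *)
Lemma cot_transitionE (c d : chart Q) y : overlap c d (lsubmx y) ->
  cot_transition c d y = row_mx (transition c d (lsubmx y))
    (rsubmx y *m ('J (transition d c) (transition c d (lsubmx y)))^T).
Proof.
move=> [x [cx dx] xy].
rewrite /cot_transition /= -xy (transition_coord _ cx) (chart_coordK hQ cx).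
have xx := dom_chart_at hQ x.
by rewrite -mulmxA -trmx_mul (jacobian_transition_comp dx xx cx).
Qed.

Lemma near_overlap_lsubmx c d (y : 'rV[R]_(n + n)) :
  overlap c d (lsubmx y) -> \forall z \near y, overlap c d (lsubmx z).
Proof. by move=> /near_overlap; exact: continuous_lsubmx. Qed.

(** The fiber component contains a Jacobian, so second derivatives of the transitions of Q enter
    here. *)
Lemma differentiable_cot_transition (c d : chart Q) y : overlap c d (lsubmx y) ->
  differentiable (cot_transition c d) y.
Proof.
move=> cdy.
suff dt : differentiable (fun y => row_mx (transition c d (lsubmx y))
    (rsubmx y *m ('J (transition d c) (transition c d (lsubmx y)))^T)) y.
  apply: (near_eq_diff _ dt).1.
  by apply: filterS (near_overlap_lsubmx cdy) => z /cot_transitionE ->.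
have dl : differentiable (transition c d \o lsubmx) y.
  by apply: differentiable_comp; [exact: differentiable_lsubmx | exact: differentiable_transition].
apply: differentiable_row_mx; first exact: dl.
apply: differentiable_mulmx; first exact: differentiable_rsubmx.
move=> i j.
rewrite (_ : (fun y => _) =
    (fun z => 'J (transition d c) z j i) \o (transition c d \o lsubmx)); last first.
  by apply/funext => z; rewrite mxE.
apply: differentiable_comp; first exact: dl.
apply: differentiable_transition_jacobian.
by case: cdy => x [cx dx] /= <-; rewrite transition_coord //; exists x.
Qed.

(** The same chart of Q is selected at [a] and at its projection. In it the projection is [lsubmx]
    near the point, a continuous linear map and hence its own differential. *)
Lemma tangent_map_proj (a : TsQ) w :
  tangent_map (@cot_proj R n Q) (a, w) = (cot_proj a, lsubmx w).
Proof.
rewrite /tangent_map /=; congr pair.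
have ax := dom_chart_at hQ a.1.
have dl := linear_differentiable (chart_coord (chart_at a) a) (@continuous_lsubmx R 1 n n).
have le : \forall z \near chart_coord (chart_at a) a, lsubmx z =
   (chart_coord (chart_at (cot_proj a)) \o @cot_proj R n Q \o chart_param (chart_at a)) z.
  have : overlap (chart_at a.1) (chart_at a.1) (lsubmx (chart_coord (chart_at a) a)).
    by rewrite row_mxKl; exists a.1.
  move=> /near_overlap_lsubmx; apply: filterS => z [x [cx _]] /= xz.
  by rewrite -xz chart_coordK.
have lE := diff_lin (chart_coord (chart_at a) a) (@continuous_lsubmx R 1 n n).
exact (etrans (congr1 (@^~ w) (near_eq_diff le dl).2) (congr1 (@^~ w) lE)).
Qed.

(* The chart d selected at the base point varies with y; the Jacobians of
   c -> d and d -> c cancel, leaving p dq. *)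
Lemma canonical_one_form_chart_vector (c : chart Q) y v :
  overlap c c (lsubmx y) ->
  canonical_one_form (@chart_vector _ _ TsQ c y v) = pairing (rsubmx y) (lsubmx v).
Proof.
move=> [x [cx _] xy].
have xx := dom_chart_at hQ x.
have px : chart_param c (lsubmx y) = x by rewrite -xy chart_coordK.
rewrite /canonical_one_form /chart_vector tangent_map_proj /= px.
set d := chart_at x in xx *.
have cdy : overlap c d (lsubmx y) by exists x.
have dct := differentiable_cot_transition cdy.
have dl := differentiable_lsubmx.
(* Near [y], [lsubmx \o cot_transition c d] agrees with [transition c d \o lsubmx]; both are
   differentiated at [y]. *)
have lctE : lsubmx ('d (cot_transition c d) y v) = lsubmx v *m 'J (transition c d) (lsubmx y).
  rewrite -diffEjacobian.
  have E1 := diff_comp dct (dl R 1 n n _).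
  have dt := differentiable_transition cdy.
  have E2 := diff_comp (dl R 1 n n y) dt.
  have tl : \forall z \near y, (transition c d \o lsubmx) z = (lsubmx \o cot_transition c d) z.
    apply: filterS (near_overlap_lsubmx cdy) => z /cot_transitionE zE.
    by rewrite /= zE row_mxKl.
  have E3 := (near_eq_diff tl (differentiable_comp (dl R 1 n n y) dt)).2.
  have lE z := diff_lin z (@continuous_lsubmx R 1 n n).
  have := etrans (etrans (esym (congr1 (@^~ v) E1)) (congr1 (@^~ v) E3)) (congr1 (@^~ v) E2).
  have e1 := congr1 (@^~ ('d (cot_transition c d) y v)) (lE (cot_transition c d y)).
  have e2 := congr1 (@^~ v) (lE y).
  move=> e; refine (etrans (esym e1) (etrans e _)).
  exact (congr1 ('d (transition c d) (lsubmx y)) e2).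
refine (etrans (congr1 (pairing _) lctE) _).
rewrite /pairing trmx_mul mulmxA -xy.
rewrite -[rsubmx y *m _ *m _]mulmxA -trmx_mul.
by rewrite (jacobian_transition_comp cx xx cx) (jacobian_transition_id cx) trmx1 mulmx1.
Qed.

End Charts.

(** * Linear symplectic algebra on R^(2n) *)

Section SymplecticForm.
Variables (R : realType) (n : nat).

(** The matrix of dq ∧ dp = - d (p dq) in the coordinates (q, p). *)
Definition symplectic_mx : 'M[R]_(n + n) := block_mx 0 1%:M (- 1%:M) 0.

Definition symplectic_form (u v : 'rV[R]_(n + n)) : R := (u *m symplectic_mx *m v^T) 0 0.

Lemma symplectic_formE u v : symplectic_form u v =
  pairing (rsubmx v) (lsubmx u) - pairing (rsubmx u) (lsubmx v).
Proof.
have pairC (p q : 'rV[R]_n) : pairing p q = pairing q p.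
  by rewrite /pairing !mxE; apply: eq_bigr => i _; rewrite !mxE mulrC.
rewrite (pairC _ (lsubmx u)).
rewrite /symplectic_form -[u in LHS]hsubmxK -[v in LHS]hsubmxK /symplectic_mx.
rewrite mul_row_block !mulmx0 !mulmx1 mulmxN mulmx1 add0r addr0.
by rewrite tr_row_mx mul_row_col mulNmx addrC [LHS]mxE [X in _ + X]mxE.
Qed.

Lemma symplectic_mx_unit : symplectic_mx \in unitmx.
Proof.
suff E : symplectic_mx *m symplectic_mx^T = 1%:M by case/mulmx1_unit: E.
rewrite /symplectic_mx tr_block_mx !trmx0 linearN /= !trmx1 mulmx_block.
by rewrite !mul0mx !mulmx0 mulmx1 mulNmx mul1mx opprK !addr0 !add0r -scalar_mx_block.
Qed.

Lemma mulmx_tr_inj (m : nat) (x y : 'rV[R]_m) :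
  (forall v : 'rV[R]_m, (x *m v^T) 0 0 = (y *m v^T) 0 0) -> x = y.
Proof.
move=> xy; apply/rowP => j; have := xy (delta_mx 0 j).
by rewrite trmx_delta -!colE !mxE.
Qed.

Lemma symplectic_form_inj x y :
  (forall v, symplectic_form x v = symplectic_form y v) -> x = y.
Proof.
move=> /mulmx_tr_inj; exact: (can_inj (mulmxK symplectic_mx_unit)).
Qed.

(** The existence half of nondegeneracy. Through it the set in [hamiltonian_vf] is inhabited, and
    [xget] does not fall back on its default 0. *)
Lemma symplectic_form_repr (l : {linear 'rV[R]_(n + n) -> R}) :
  exists x, forall v, symplectic_form x v = l v.
Proof.
exists ((\row_j l (delta_mx 0 j)) *m invmx symplectic_mx) => v.
rewrite /symplectic_form mulmxKV ?symplectic_mx_unit // [in RHS](row_sum_delta v) linear_sum mxE.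
by apply: eq_bigr => j _; rewrite !mxE linearZ mulrC.
Qed.

(** Preservation says that J Ω J^T = Ω for Ω = [symplectic_mx]; as Ω is invertible, so is its square
    factor J. *)
Lemma symplectic_form_preserving_unit (J : 'M[R]_(n + n)) :
  (forall u v, symplectic_form (u *m J) (v *m J) = symplectic_form u v) ->
  J \in unitmx.
Proof.
move=> hJ; suff : J *m symplectic_mx *m J^T \in unitmx.
  by rewrite !unitmx_mul => /andP[/andP[]].
rewrite (_ : _ *m _ = symplectic_mx) ?symplectic_mx_unit //.
apply/row_matrixP => i; rewrite !rowE; apply: mulmx_tr_inj => v.
by have := hJ (delta_mx 0 i) v; rewrite /symplectic_form trmx_mul !mulmxA.
Qed.

(** The value of p dq at the point [y] on the constant field [v], as a function of [y]. It is linear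
    in [y], hence its own differential. *)
Definition momentum (v y : 'rV[R]_(n + n)) : R := pairing (rsubmx y) (lsubmx v).

Lemma momentum_is_linear v : linear (momentum v).
Proof.
by move=> a x y; rewrite /momentum /pairing linearP mulmxDl -scalemxAl [LHS]mxE [X in X + _]mxE.
Qed.

HB.instance Definition _ v :=
  GRing.isLinear.Build R 'rV[R]_(n + n) R _ (momentum v) (momentum_is_linear v).

Lemma momentum_differentiable v y : differentiable (momentum v) y.
Proof.
apply: differentiable_mx_entry; apply: differentiable_mulmx.
  exact: differentiable_rsubmx.
by move=> i j; exact: differentiable_cst.
Qed.

Lemma diff_momentum v y : 'd (momentum v) y = momentum v :> (_ -> _).
Proof.
apply: diff_lin => z; exact/differentiable_continuous/momentum_differentiable.
Qed.

End SymplecticForm.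

(** * The canonical form in charts, Hamiltonian vector fields and tangent maps *)

Section Hamiltonian.
Variables (R : realType) (n : nat) (Q : charted_space R n) (hQ : is_manifold Q).
Local Notation TsQ := (cotangent Q).

(** Near the point, the canonical one-form on a constant field [w] is [momentum w]. So the two
    derivatives in [omega] are [momentum u v] and [momentum v u], independent of [a]. *)
Lemma omegaE (a : TsQ) u v : omega a u v = symplectic_form u v.
Proof.
rewrite symplectic_formE /omega /exterior_derivative opprB.
set c := chart_at a; set y := chart_coord c a.
have cy : @overlap R n Q c c (lsubmx y).
  have ax := dom_chart_at hQ a.1.
  by rewrite /y /= row_mxKl; exists a.1.
have dE w : 'd (fun z => canonical_one_form (chart_vector c z w) : R) y = momentum w :> (_ -> _).
  have nE : \forall z \near y, momentum w z = canonical_one_form (chart_vector c z w).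
    apply: filterS (near_overlap_lsubmx hQ cy) => z cz.
    exact (esym (canonical_one_form_chart_vector hQ w cz)).
  exact (etrans (near_eq_diff nE (momentum_differentiable w y)).2 (diff_momentum w y)).
exact (f_equal2 (fun s t => s - t) (congr1 (@^~ v) (dE u)) (congr1 (@^~ u) (dE v))).
Qed.

Lemma hamiltonian_vf_unique (K : TsQ -> R) (a : TsQ) X :
  (forall v, omega a X v = differential K a v) -> hamiltonian_vf K a = (a, X).
Proof.
move=> hX; congr pair; apply: xget_unique => // Y hY.
by apply: symplectic_form_inj => v; rewrite -!(omegaE a) hX hY.
Qed.

(** ['d] is a linear map by its type, so the form represents it; in particular this applies directly
    to [K \o eps]. *)
Lemma omega_hamiltonian_vf (K : TsQ -> R) (a : TsQ) v :
  omega a (hamiltonian_vf K a).2 v = differential K a v.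
Proof.
have [X hX] := symplectic_form_repr
  ('d (K \o chart_param (chart_at a)) (chart_coord (chart_at a) a)).
have {}hX w : omega a X w = differential K a w by rewrite omegaE hX.
by rewrite (hamiltonian_vf_unique hX) hX.
Qed.

(** With X the Hamiltonian vector of K o eps at [a], omega (T eps X, T eps w) = omega (X, w) = d(K o
    eps) (w) = dK (T eps w). Since T eps is onto, T eps X satisfies the equation that characterizes
    X_K at [eps a]. *)
Lemma tangent_map_symplectic (eps : TsQ -> TsQ) (K : TsQ -> R) (a : TsQ) :
  symplectic eps -> smooth_fun setT K ->
  tangent_map eps (hamiltonian_vf (K \o eps) a) = hamiltonian_vf K (eps a).
Proof.
move=> [seps oeps] sK.
set X := (hamiltonian_vf (K \o eps) a).2.
have XE : hamiltonian_vf (K \o eps) a = (a, X) by [].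
pose J := 'J (chart_coord (chart_at (eps a)) \o eps \o chart_param (chart_at a))
  (chart_coord (chart_at a) a).
have TE w : (tangent_map eps (a, w)).2 = w *m J by rewrite -diffEjacobian.
(* The forms at [a] and at [eps a] are the same constant form by [omegaE], so J preserves a single
   form. *)
have Ju : J \in unitmx.
  apply: symplectic_form_preserving_unit => u v.
  by rewrite -!TE -(omegaE (eps a)) oeps omegaE.
rewrite XE (@hamiltonian_vf_unique K (eps a) (tangent_map eps (a, X)).2) // => v.
have -> : v = (tangent_map eps (a, v *m invmx J)).2 by rewrite TE mulmxKV.
rewrite oeps omega_hamiltonian_vf.
apply: differential_comp => //; try exact: cot_coordK; exact: dom_cot_chart_at.
Qed.

Lemma tangent_map_comp_proj (gamma : Q -> TsQ) (w : tangent TsQ) :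
  smooth_map gamma ->
  tangent_map (gamma \o @cot_proj R n Q) w =
  tangent_map gamma (tangent_map (@cot_proj R n Q) w).
Proof.
case: w => a w sg; rewrite tangent_map_proj //.
rewrite /tangent_map; congr pair.
pose c := chart_at (cot_proj a); pose d := chart_at (gamma (cot_proj a)).
have [_ /(_ 1) [dg _]] := sg c d.
pose Y : 'rV[R]_(n + n) := @chart_coord _ _ TsQ (chart_at a) a.
have YE : lsubmx Y = chart_coord c (cot_proj a) by rewrite row_mxKl.
have {}dg : differentiable (chart_coord d \o gamma \o chart_param c) (lsubmx Y).
  apply: dg; exists (cot_proj a); last by rewrite YE.
  by split; [exact: dom_chart_at | exact: dom_cot_chart_at].
have dl := differentiable_lsubmx Y.
have lE := diff_lin Y (@continuous_lsubmx R 1 n n).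
have e1 := congr1 (@^~ w) (diff_comp dl dg).
have e2 := congr1 ('d (chart_coord d \o gamma \o chart_param c) (lsubmx Y))
  (congr1 (@^~ w) lE).
have e3 : 'd ((chart_coord d \o gamma \o chart_param c) \o lsubmx) Y w =
    'd (chart_coord d \o gamma \o chart_param c) (chart_coord c (cot_proj a)) (lsubmx w).
  rewrite -YE.
  exact (etrans e1 e2).
(* Unfolding turns the chart expression of [gamma \o cot_proj] into that of [gamma] precomposed with
   [lsubmx], so [e3] is the goal up to conversion. *)
exact e3.
Qed.

End Hamiltonian.

Theorem theorem2p7 (R : realType) (n : nat) (Q : charted_space R n)
    (hQ : is_manifold Q)
    (g : cotangent Q -> 'rV[R]_(n + n) -> 'rV[R]_(n + n) -> R)
    (hg : riemannian_metric g)
    (S : RCH_system Q)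
    (u : cotangent Q -> cotangent Q) (hu : control_law S u)
    (gamma : Q -> cotangent Q) (hgamma : one_form gamma)
    (eps : cotangent Q -> cotangent Q) (heps : symplectic eps) :
  let H := hamiltonian S in
  let X := dynamical_vf g S u in
  let lambda := gamma \o @cot_proj R n Q in
  let Xeps := tangent_map (@cot_proj R n Q) \o X \o eps in
  tangent_map eps \o hamiltonian_vf (H \o eps) =
    tangent_map lambda \o X \o eps
  <->
  tangent_map gamma \o Xeps = hamiltonian_vf H \o eps.
Proof.
move=> H X lambda Xeps.
have E1 : tangent_map eps \o hamiltonian_vf (H \o eps) = hamiltonian_vf H \o eps.
  apply: funext => a.
  exact (tangent_map_symplectic hQ a heps (hamiltonian_smooth S)).
have E2 : tangent_map lambda \o X \o eps = tangent_map gamma \o Xeps.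
  apply: funext => a.
  exact (tangent_map_comp_proj hQ (X (eps a)) hgamma.1).
split=> e; first exact (etrans (esym E2) (etrans (esym e) E1)).
exact (etrans E1 (etrans (esym e) (esym E2))).
Qed.
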